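(* Let $\mathcal{B}=\{b_1,\dots,b_{11}\}$ be the eleven base vulnerabilities of the Vulnerability Factory and, for each $n\in\mathbb{N}$, let $V(M_n)=\{v_{n,1},v_{n,2},v_{n,3},v_{n,4},v_{n,5}\}$ be the five vulnerabilities of the $n$-th generated module $M_n$. Then the set \[ \mathcal{V}=\mathcal{B}\;\cup\;\bigcup_{n=0}^{\infty}V(M_n) \] is countably infinite, and every element of $\mathcal{V}$ is CVE-assignable.
   Context: A vulnerability is a tuple $(c,t,p)$ where $c$ is a software component (an identifiable compilation unit), $t$ is a CWE-classified weakness type, and $p$ is a parameter set determining the specific exploit conditions. Two vulnerabilities $(c_1,t_1,p_1)$ and $(c_2,t_2,p_2)$ are distinct if $c_1\neq c_2$ or $p_1\neq p_2$. A vulnerability $(c,t,p)$ is CVE-assignable if (i) $t$ corresponds to a recognised CWE with established CVE precedent, (ii) $c$ is an identifiable software component, and (iii) the vulnerability is independently fixable without altering other components. The Vulnerability Factory is a C program consisting of: a base set of eleven functions $b_1,\dots,b_{11}$, each containing exactly one vulnerability of a distinct CWE class (CWE-121 stack buffer overflow, CWE-122 heap buffer overflow, CWE-134 format string, CWE-190 integer overflow, CWE-416 use after free, CWE-415 double free, CWE-78 OS command injection, CWE-367 TOCTOU race, CWE-476 NULL pointer dereference, CWE-457 uninitialised variable, CWE-22 path traversal); and a generator which, on each execution, reads a persistent counter $n\in\mathbb{N}$, emits and compiles a new C source file into a separate shared library $M_n$, and increments $n$. Module $M_n$ contains five vulnerabilities: $v_{n,1}$, a CWE-121 stack buffer overflow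 (\texttt{strcpy} into a buffer of size $16+n$ without bounds checking); $v_{n,2}$, a CWE-134 format string vulnerability (user input used as a \texttt{printf} format) in module $n$; $v_{n,3}$, a CWE-190 integer overflow with threshold $\texttt{INT\_MAX}-n$; $v_{n,4}$, a CWE-416 use-after-free with allocation size $8+n$; $v_{n,5}$, a CWE-78 OS command injection (unsanitised input to \texttt{system()}) in the module-$n$ context. Distinct vulnerabilities in distinct components receive distinct CVE identifiers under MITRE's CVE Counting Rules. *)

(* Defs.v *)
From Stdlib Require Import ZArith List.
From mathcomp Require Import all_boot.
From mathcomp Require Import boolp classical_sets cardinality.

Set Implicit Arguments.
Unset Strict Implicit.
Unset Printing Implicit Defensive.

Local Open Scope classical_set_scope.

(** * Execution traces of C functions *)

(* Character codes, without the terminating NUL. *)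
Definition cstring := seq nat.

Definition INT_MAX : Z := 2147483647.
Definition INT_MIN : Z := (-2147483648)%Z.

Inductive region := Stack | Heap.

(* A call-site context: [Some n] in code generated for module [n], [None] in
   the hand-written base program. *)
Definition site := option nat.

Inductive event :=
| Alloc of nat & region & nat   (* block, region, size *)
| Free of nat
| Access of option nat & nat    (* pointer ([None] is NULL), number of bytes touched *)
| SetVar of nat
| GetVar of nat
| AddInt of Z & nat             (* signed [int] addition of a nonnegative constant *)
| Printf of site & cstring & nat (* format, number of variadic arguments *)
| System of site & cstring      (* externally supplied part of the command line *)
| CheckPath of cstring          (* [access]/[stat] on a path *)
| OpenPath of cstring.

Definition trace := seq event.

(* Most recent allocation of block [b]: region, size, and whether it is live. *)
Definition block_step (b : nat) (st : option (region * nat * bool)) (e : event) :=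
  match e with
  | Alloc b' r n => if b' == b then Some (r, n, true) else st
  | Free b' => if b' == b then omap (fun x => (x.1, false)) st else st
  | _ => st
  end.

Definition block (tr : trace) (b : nat) : option (region * nat * bool) :=
  foldl (block_step b) None tr.

(* Number of conversion specifications; 37 is the percent sign, and a doubled
   percent sign prints itself. *)
Fixpoint conversions (s : cstring) : nat :=
  if s is c :: s1 then
    if c == 37 then
      if s1 is d :: s2 then (d != 37) + conversions s2 else 0
    else conversions s1
  else 0.

(* newline, dollar, ampersand, parentheses, semicolon, less, greater,
   backquote, bar *)
Definition shell_meta : seq nat := [:: 10; 36; 38; 40; 41; 59; 60; 62; 96; 124].

(* Some slash-separated component of the path is the parent directory
   (46 is the dot, 47 the slash). *)
Definition climbs (s : cstring) : bool := infix [:: 47; 46; 46; 47] (47 :: rcons s 47).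

(** * Vulnerabilities *)

(* Exploit conditions. *)
Inductive param :=
| StackBuffer of nat            (* buffer size *)
| HeapBuffer of nat             (* buffer size *)
| FormatIn of site
| OverflowFrom of Z             (* least operand for which the addition overflows *)
| FreedBlockUse of nat          (* allocation size *)
| FreedBlockFree of nat         (* allocation size *)
| CommandIn of site
| CheckThenOpen
| NullPointer
| UninitVar of nat
| ParentPath.

(* [weak pre e t p]: after [pre], the event [e] realises the weakness CWE-[t]
   under the exploit condition [p]. *)
Inductive weak (pre : trace) : event -> nat -> param -> Prop :=
| Stack_overflow b n m : block pre b = Some (Stack, n, true) -> n < m ->
    weak pre (Access (Some b) m) 121 (StackBuffer n)
| Heap_overflow b n m : block pre b = Some (Heap, n, true) -> n < m ->
    weak pre (Access (Some b) m) 122 (HeapBuffer n)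
| Format_string s f k : k < conversions f ->
    weak pre (Printf s f k) 134 (FormatIn s)
| Integer_overflow x d :
    (INT_MIN <= x <= INT_MAX)%Z -> (INT_MAX < x + Z.of_nat d)%Z ->
    weak pre (AddInt x d) 190 (OverflowFrom (INT_MAX + 1 - Z.of_nat d))
| Use_after_free b n m : block pre b = Some (Heap, n, false) ->
    weak pre (Access (Some b) m) 416 (FreedBlockUse n)
| Double_free b n : block pre b = Some (Heap, n, false) ->
    weak pre (Free b) 415 (FreedBlockFree n)
| Command_injection s a : has [in shell_meta] a ->
    weak pre (System s a) 78 (CommandIn s)
| Toctou_race q : List.In (CheckPath q) pre ->
    weak pre (OpenPath q) 367 CheckThenOpen
| Null_dereference m :
    weak pre (Access None m) 476 NullPointer
| Uninitialised_use x : ~ List.In (SetVar x) pre ->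
    weak pre (GetVar x) 457 (UninitVar x)
| Path_traversal q : climbs q ->
    weak pre (OpenPath q) 22 ParentPath.

Definition faults (tr : trace) (t : nat) (p : param) : Prop :=
  exists pre e post, tr = pre ++ e :: post /\ weak pre e t p.

(* A C function, by the trace it produces on each input (a string and an
   [int] argument). *)
Definition cfun := cstring * Z -> trace.

Definition exhibits (f : cfun) (t : nat) (p : param) : Prop :=
  exists x, faults (f x) t p.

(* Components are named by elements of [C]; [cwe] is the CWE number. *)
Record vulnerability (C : Type) := Vuln { component : C; cwe : nat; par : param }.

Definition distinct (C : Type) (v w : vulnerability C) : Prop :=
  component v <> component w \/ par v <> par w.

(* The functions of a compilation unit. *)
Definition source := seq cfun.

Definition code (u : source) (j : nat) : cfun := nth (fun=> [::]) u j.

(* The compilation units installed on a system, with their names. *)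
Definition deployment (C : eqType) := seq (C * source).

Definition names (C : eqType) (D : deployment C) : seq C := [seq d.1 | d <- D].

Definition unit_of (C : eqType) (D : deployment C) (c : C) (u : source) : Prop :=
  List.In (c, u) D.

Definition present (C : eqType) (D : deployment C) (v : vulnerability C) : Prop :=
  exists u j, [/\ unit_of D (component v) u, j < size u
                & exhibits (code u j) (cwe v) (par v)].

(* [u'] is obtained from [u] by changing the behaviour of its functions only on
   inputs that trigger the weakness. *)
Definition patches (t : nat) (p : param) (u u' : source) : Prop :=
  size u' = size u /\
  forall j x, j < size u -> ~ faults (code u j x) t p -> code u' j x = code u j x.

(* Some patch confined to the component of [v] removes [v] and leaves every
   other vulnerability as it was. *)
Definition independently_fixable (C : eqType) (D : deployment C)
    (v : vulnerability C) : Prop :=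
  present D v /\
  exists D' : deployment C,
    [/\ List.Forall2 (fun d d' : C * source => d'.1 = d.1 /\
          if d.1 == component v then patches (cwe v) (par v) d.2 d'.2
          else d'.2 = d.2) D D',
        ~ present D' v
      & forall w, w <> v -> (present D' w <-> present D w)].

(** * The Vulnerability Factory *)

Definition base_cwe : 11.-tuple nat :=
  [tuple 121; 122; 134; 190; 416; 415; 78; 367; 476; 457; 22].

(* [main] is the compilation unit holding the base functions and [lib n] the
   shared library built when the counter is [n]. *)
Record factory (C : eqType) := Factory {
  main : C;
  lib : nat -> C;
  lib_inj : injective lib;
  lib_main : forall n, lib n <> main;
  base : 11.-tuple cfun;
  base_par : 11.-tuple param;
  base_exactly_one : forall (i : 'I_11) t p,
    exhibits (tnth base i) t p <-> t = tnth base_cwe i /\ p = tnth base_par i }.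

(* [strcpy] also copies the terminator.  Adding [n + 1] to an [int] overflows
   exactly when that [int] is at least [INT_MAX - n]. *)
Definition module_source (n : nat) : source := [::
  fun x => [:: Alloc 0 Stack (16 + n); Access (Some 0) (size x.1).+1];
  fun x => [:: Printf (Some n) x.1 0];
  fun x => [:: AddInt x.2 n.+1];
  fun x => [:: Alloc 0 Heap (8 + n); Free 0; Access (Some 0) 1];
  fun x => [:: System (Some n) x.1]].

Record state (C : eqType) := State { counter : nat; installed : deployment C }.

Definition generate (C : eqType) (F : factory C) (s : state C) : state C :=
  State (counter s).+1
        (rcons (installed s) (lib F (counter s), module_source (counter s))).

(* The system after [k] executions of the generator. *)
Definition deployed (C : eqType) (F : factory C) (k : nat) : deployment C :=
  installed (iter k (generate F) (State 0 [:: (main F, tval (base F))])).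

Definition base_vulns (C : eqType) (F : factory C) : set (vulnerability C) :=
  [set Vuln (main F) (tnth base_cwe i) (tnth (base_par F) i) | i in [set: 'I_11]].

Definition module_vulns (C : eqType) (F : factory C) (n : nat) :
    set (vulnerability C) :=
  [set Vuln (lib F n) 121 (StackBuffer (16 + n));
       Vuln (lib F n) 134 (FormatIn (Some n));
       Vuln (lib F n) 190 (OverflowFrom (INT_MAX - Z.of_nat n));
       Vuln (lib F n) 416 (FreedBlockUse (8 + n));
       Vuln (lib F n) 78 (CommandIn (Some n))].

Definition factory_vulns (C : eqType) (F : factory C) : set (vulnerability C) :=
  base_vulns F `|` \bigcup_n module_vulns F n.

(** * CVE assignability *)

(* [c] gets built, and its name never denotes two units of the same system. *)
Definition identifiable (C : eqType) (F : factory C) (c : C) : Prop :=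
  (exists k, c \in names (deployed F k)) /\
  forall k, count_mem c (names (deployed F k)) <= 1.

(* [recognised] is the set of CWE numbers with established CVE precedent. *)
Definition cve_assignable (C : eqType) (recognised : set nat) (F : factory C)
    (v : vulnerability C) : Prop :=
  [/\ recognised (cwe v),
      identifiable F (component v)
    & forall k, component v \in names (deployed F k) ->
        independently_fixable (deployed F k) v].

(* Main.v *)
(** Every function of the factory exhibits exactly one pair of a weakness and an
exploit condition.  Hence making a function return the empty trace on the inputs
that trigger a given vulnerability removes that vulnerability and no other one.
Moreover the exploit condition determines the CWE number, so that two different
vulnerabilities of the factory are distinct.  The set is infinite because the
libraries have pairwise different names. *)

Require Import Defs.
From Stdlib Require Import ZArith List Lia.
From mathcomp Require Import all_boot.
From mathcomp Require Import boolp classical_sets cardinality.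

Local Open Scope classical_set_scope.
Local Open Scope card_scope.

(** * Patching functions that have a single fault *)

Definition single_fault (f : cfun) : Prop :=
  forall t p t' p', exhibits f t p -> exhibits f t' p' -> t = t' /\ p = p'.

Definition patch_fun (t : nat) (p : param) (f : cfun) : cfun :=
  fun x => if `[< faults (f x) t p >] then [::] else f x.

(** Every function of the unit is patched, since several of them may exhibit the same weakness under
    the same exploit condition. *)
Definition patch_at {C : eqType} (v : vulnerability C) (d : C * source) :
    C * source :=
  if d.1 == component v then (d.1, map (patch_fun (cwe v) (par v)) d.2) else d.

Lemma faults_nil t p : ~ faults [::] t p.
Proof. by move=> [[|? ?] [? [? []]]]. Qed.

Lemma faults_cons e tr t p :
  faults (e :: tr) t p <->
  weak [::] e t p \/
  exists pre e' post, tr = pre ++ e' :: post /\ weak (e :: pre) e' t p.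
Proof.
split=> [[[|a pre] [e' [post [/= [-> Etr] w]]]]|[w|[pre [e' [post [-> w]]]]]].
- by left.
- by right; exists pre, e', post.
- by exists [::], e, tr.
- by exists (e :: pre), e', post.
Qed.

Lemma faults_patch_fun t p f x t' p' :
  faults (patch_fun t p f x) t' p' <->
  ~ faults (f x) t p /\ faults (f x) t' p'.
Proof.
rewrite /patch_fun; case: asboolP => h; last by split=> // -[].
by split=> [/faults_nil//|[]].
Qed.

Lemma exhibits_patch_fun t p f : ~ exhibits (patch_fun t p f) t p.
Proof. by move=> [x /faults_patch_fun[]]. Qed.

(** An input could trigger two faults at once, and emptying its trace would then lose both;
    [single_fault] excludes this. *)
Lemma exhibits_patch_fun_other t p f t' p' :
  single_fault f -> (t', p') <> (t, p) ->
  exhibits (patch_fun t p f) t' p' <-> exhibits f t' p'.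
Proof.
move=> f1 ne; split=> [[x /faults_patch_fun[_ fx]]|[x fx]]; first by exists x.
exists x; apply/faults_patch_fun; split=> // fx'.
by apply: ne; have [-> ->] : t' = t /\ p' = p by apply: f1; exists x.
Qed.

Lemma code_patch t p u j x :
  j < size u -> code (map (patch_fun t p) u) j x = patch_fun t p (code u j) x.
Proof. by move=> ju; rewrite /code (nth_map (fun=> [::])). Qed.

Lemma exhibits_code_patch t p u j t' p' : j < size u ->
  exhibits (code (map (patch_fun t p) u) j) t' p' <->
  exhibits (patch_fun t p (code u j)) t' p'.
Proof. by move=> ju; rewrite /code (nth_map (fun=> [::])). Qed.

Lemma unit_of_patch {C : eqType} (v : vulnerability C) (D : deployment C) c u' :
  unit_of (map (patch_at v) D) c u' <->
  exists2 u, unit_of D c u &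
    u' = if c == component v then map (patch_fun (cwe v) (par v)) u else u.
Proof.
rewrite /unit_of in_map_iff; split=> [[[c0 u] []]|[u Du ->]].
  by rewrite /patch_at /=; case: ifP => h [<- <-] Du; exists u; rewrite ?h.
by exists (c, u); split=> //; rewrite /patch_at /=; case: ifP.
Qed.

(** The witness for the fixed system is [map (patch_at v) D]. Patching only shrinks the set of
    faults, so nothing new appears; what could be lost is handled by [exhibits_patch_fun_other]. *)
Lemma single_fault_independently_fixable {C : eqType} (D : deployment C) v :
  (forall c u j, unit_of D c u -> j < size u -> single_fault (code u j)) ->
  present D v -> independently_fixable D v.
Proof.
move=> D1 Dv; split=> //; exists (map (patch_at v) D); split.
- elim: D {D1 Dv} => [|d D IH] /=; constructor=> //.
  rewrite /patch_at; case: ifP => //= _; split=> //; split.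
    by rewrite size_map.
  by move=> j x ju nf; rewrite code_patch // /patch_fun; case: asboolP.
- move=> [u' [j [/unit_of_patch[u Du ->]]]]; rewrite eqxx size_map => ju.
  by move/(exhibits_code_patch _ _ _ _ _ _ ju)/exhibits_patch_fun.
- move=> w wv; split.
    move=> [u' [j [/unit_of_patch[u Du ->]]]]; case: ifP => [_|_ ju ex].
      rewrite size_map => ju /(exhibits_code_patch _ _ _ _ _ _ ju)[x].
      by move=> /faults_patch_fun[_ fx]; exists u, j; split=> //; exists x.
    by exists u, j.
  move=> [u [j [Du ju ex]]].
  exists (if component w == component v
          then map (patch_fun (cwe v) (par v)) u else u), j.
  split; first by apply/unit_of_patch; exists u.
    by case: ifP; rewrite ?size_map.
  case: ifP => // /eqP cwv; apply/(exhibits_code_patch _ _ _ _ _ _ ju).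
  apply/exhibits_patch_fun_other => //; first exact: D1 Du ju.
  (* Here [w] and [v] share their component, so [w <> v] forces the pairs of CWE number and
     parameter to differ. *)
  by case=> tE pE; apply: wv; case: w v cwv tE pE {D1 Dv Du ex}
    => [? ? ?] [? ? ?] /= -> -> ->.
Qed.

(** * Weaknesses of the generated modules *)

Definition par_cwe (p : param) : nat :=
  match p with
  | StackBuffer _ => 121
  | HeapBuffer _ => 122
  | FormatIn _ => 134
  | OverflowFrom _ => 190
  | FreedBlockUse _ => 416
  | FreedBlockFree _ => 415
  | CommandIn _ => 78
  | CheckThenOpen => 367
  | NullPointer => 476
  | UninitVar _ => 457
  | ParentPath => 22
  end.

Lemma exhibits_par_cwe f t p : exhibits f t p -> t = par_cwe p.
Proof. by move=> [x [pre [e [post [_ []]]]]]. Qed.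

Definition module_weakness (n : nat) : seq (nat * param) :=
  [:: (121, StackBuffer (16 + n)); (134, FormatIn (Some n));
      (190, OverflowFrom (INT_MAX - Z.of_nat n));
      (416, FreedBlockUse (8 + n)); (78, CommandIn (Some n))].

Lemma overflow_threshold n :
  (INT_MAX + 1 - Z.of_nat n.+1 = INT_MAX - Z.of_nat n)%Z.
Proof. lia. Qed.

(** An access through a non-null pointer can realise three weaknesses; the region and liveness of
    the block select at most one. *)
Lemma weak_access pre b m t p : weak pre (Access (Some b) m) t p ->
  match block pre b with
  | Some (Stack, n, true) => (t, p) = (121, StackBuffer n)
  | Some (Heap, n, true) => (t, p) = (122, HeapBuffer n)
  | Some (Heap, n, false) => (t, p) = (416, FreedBlockUse n)
  | _ => False
  end.
Proof.
by move=> w; inversion w; subst; match goal with E : block _ _ = _ |- _ =>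
  rewrite E end.
Qed.

Lemma weak_free pre b t p : weak pre (Free b) t p ->
  exists n, block pre b = Some (Heap, n, false).
Proof. by move=> w; inversion w; subst; eexists; eassumption. Qed.

(* Otherwise [simpl] diverges on differences with [INT_MAX]. *)
Local Arguments Z.sub : simpl never.

(** From left to right, each event of the short trace is inverted; from right to left, an explicit
    exploit input is given. *)
Lemma exhibits_module n j t p : j < 5 ->
  exhibits (code (module_source n) j) t p <->
  (t, p) = nth (121, StackBuffer (16 + n)) (module_weakness n) j.
Proof.
have inv1 e t' p' : faults [:: e] t' p' <-> weak [::] e t' p'.
  split; first by case/faults_cons => // -[[|? ?] [? [? []]]].
  by move=> w; apply/faults_cons; left.
case: j => [|[|[|[|[|//]]]]] _; rewrite /code /=; split.
- move=> [x /faults_cons[w|]]; first by inversion w.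
  by move=> [[|a [|? ?]] [e [post [] //=]]] [<- _] /weak_access.
(* The shortest overflowing string: it fills the buffer, and its terminator is written one byte past
   the end. *)
- move=> [-> ->]; exists (nseq (16 + n) 0, 0%Z).
  exists [:: Alloc 0 Stack (16 + n)], (Access (Some 0) (16 + n).+1), [::].
  by rewrite size_nseq; split=> //; apply: Stack_overflow.
- by move=> [x /inv1 w]; inversion w.
(* The format [%d], for which no variadic argument is supplied. *)
- move=> [-> ->]; exists ([:: 37; 100], 0%Z); apply/inv1.
  exact: Format_string.
- move=> [x /inv1 w]; inversion w; subst.
  by rewrite overflow_threshold.
(* Adding [n.+1], which is positive, to [INT_MAX] overflows for every [n]. *)
- move=> [-> ->]; exists ([::], INT_MAX); apply/inv1.
  rewrite -overflow_threshold.
  by constructor; cbv [fst snd]; rewrite /INT_MIN /INT_MAX; lia.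
- move=> [x /faults_cons[w|]]; first by inversion w.
  (* The faulty event is the [Free] or the [Access]. The former acts on a live block and so is no
     double free; the latter is a use after free. *)
  move=> [[|a [|b [|? ?]]] [e [post [] //=]]].
    by case=> <- _ /weak_free[].
  by case=> <- <- _ /weak_access.
- move=> [-> ->]; exists ([::], 0%Z).
  exists [:: Alloc 0 Heap (8 + n); Free 0], (Access (Some 0) 1), [::].
  by split=> //; apply: Use_after_free.
- by move=> [x /inv1 w]; inversion w.
(* Code 59 is the semicolon, a shell metacharacter. *)
- move=> [-> ->]; exists ([:: 59], 0%Z); apply/inv1.
  exact: Command_injection.
Qed.

Lemma module_single_fault n j :
  j < 5 -> single_fault (code (module_source n) j).
Proof.
move=> j5 t p t' p' /(exhibits_module _ _ _ _ j5) E.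
by move=> /(exhibits_module _ _ _ _ j5); rewrite -E => -[-> ->].
Qed.

(** * Systems reached by the generator and their vulnerabilities *)

Section Factory.
Context {C : eqType} (F : factory C).

Lemma base_single_fault (i : 'I_11) : single_fault (tnth (base F) i).
Proof.
by move=> t p t' p' /base_exactly_one[-> ->] /base_exactly_one[-> ->].
Qed.

Lemma counter_iter_generate k s :
  counter (iter k (generate F) s) = counter s + k.
Proof. by elim: k => [|k IH] /=; rewrite ?addn0 // IH addnS. Qed.

Lemma deployedE k :
  deployed F k = (main F, tval (base F)) ::
                 [seq (lib F i, module_source i) | i <- iota 0 k].
Proof.
elim: k => // k IH; rewrite -[X in iota _ X]addn1 iotaD cats1 map_rcons.
rewrite -rcons_cons -IH.
by rewrite /deployed /= counter_iter_generate.
Qed.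

Lemma names_deployedE k :
  names (deployed F k) = main F :: [seq lib F i | i <- iota 0 k].
Proof. by rewrite deployedE /names /= -map_comp. Qed.

Lemma names_deployed_uniq k : uniq (names (deployed F k)).
Proof.
rewrite names_deployedE /= map_inj_uniq ?iota_uniq ?andbT; last exact: lib_inj.
by apply/mapP => -[n _ /esym]; apply: lib_main.
Qed.

Lemma lib_in_names k n : (lib F n \in names (deployed F k)) = (n < k).
Proof.
rewrite names_deployedE inE mem_map; last exact: lib_inj.
by rewrite mem_iota add0n leq0n; case: eqP => // /lib_main.
Qed.

Lemma unit_of_deployed k c u : unit_of (deployed F k) c u <->
  (c, u) = (main F, tval (base F)) \/
  exists2 n, n < k & (c, u) = (lib F n, module_source n).
Proof.
rewrite /unit_of deployedE /= in_map_iff.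
have iotaP n : List.In n (iota 0 k) <-> n < k.
  rewrite -[n < k](mem_iota 0 k n); elim: (iota 0 k) => //= a s IH; rewrite inE.
  split=> [[->|/IH ->]|/orP[/eqP ->|/IH]]; rewrite ?eqxx ?orbT //; [by left|].
  by right.
split=> [[<-|[n [<- /iotaP nk]]]|[->|[n nk ->]]]; [by left| |by left|].
  by right; exists n.
by right; exists n; split=> //; apply/iotaP.
Qed.

Lemma deployed_single_fault k c u j :
  unit_of (deployed F k) c u -> j < size u -> single_fault (code u j).
Proof.
case/unit_of_deployed => [[_ ->]|[n _ [_ ->]]]; last exact: module_single_fault.
rewrite size_tuple => j11.
have := base_single_fault (Ordinal j11).
by rewrite (tnth_nth (fun=> [::])).
Qed.

Lemma present_base k (i : 'I_11) :
  present (deployed F k) (Vuln (main F) (tnth base_cwe i) (tnth (base_par F) i)).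
Proof.
exists (tval (base F)), i; split=> /=; last 2 first.
- by rewrite size_tuple.
- by rewrite /code -tnth_nth; apply/base_exactly_one.
by apply/unit_of_deployed; left.
Qed.

Lemma module_vulnsP n v : module_vulns F n v ->
  exists2 j, j < 5 &
  v = let: (t, p) := nth (121, StackBuffer (16 + n)) (module_weakness n) j in
      Vuln (lib F n) t p.
Proof.
by move=> [[[[]|]|]|] ->; [exists 0|exists 1|exists 2|exists 3|exists 4].
Qed.

Lemma present_module k n v :
  n < k -> module_vulns F n v -> present (deployed F k) v.
Proof.
move=> nk /module_vulnsP[j j5 ->]; exists (module_source n), j.
case E: (nth _ _ _) => [t p] /=; split=> //.
  by apply/unit_of_deployed; right; exists n.
by apply/exhibits_module => //; rewrite E.
Qed.

Lemma component_module n v : module_vulns F n v -> component v = lib F n.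
Proof. by move=> [[[[]|]|]|] ->. Qed.

Lemma factory_vulns_present k v : factory_vulns F v ->
  component v \in names (deployed F k) -> present (deployed F k) v.
Proof.
move=> [[i _ <-] _|[n _ nv]]; first exact: present_base.
rewrite (component_module n) // lib_in_names => nk.
exact: (present_module k n).
Qed.

Lemma factory_vulns_built v : factory_vulns F v ->
  exists k, component v \in names (deployed F k).
Proof.
move=> [[i _ <-]|[n _ nv]]; first by exists 0; rewrite names_deployedE mem_head.
by exists n.+1; rewrite (component_module n) // lib_in_names.
Qed.

(** Each vulnerability is exhibited by real code once its component is built, and there
    [exhibits_par_cwe] applies. *)
Lemma factory_vulns_par_cwe v : factory_vulns F v -> cwe v = par_cwe (par v).
Proof.
move=> Fv; have [k /(factory_vulns_present k v Fv)] := factory_vulns_built v Fv.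
by move=> [u [j [_ _ /exhibits_par_cwe]]].
Qed.

(** [distinct] does not compare CWE numbers, so two vulnerabilities differing only there must be
    ruled out: the parameter determines the number. *)
Lemma factory_vulns_distinct v w :
  factory_vulns F v -> factory_vulns F w -> v <> w -> distinct v w.
Proof.
move=> /factory_vulns_par_cwe Ev /factory_vulns_par_cwe Ew vw.
have [c|] := pselect (component v = component w); last by left.
right=> p; apply: vw; move: Ev Ew c p.
by case: v w => [? ? ?] [? ? ?] /= -> -> -> ->.
Qed.

(** The five classes used by the modules already occur among the base classes, so recognising the
    latter suffices. *)
Lemma factory_vulns_cwe v : factory_vulns F v -> cwe v \in tval base_cwe.
Proof.
move=> [[i _ <-]|[n _]]; first exact: mem_tnth.
by move=> [[[[]|]|]|] ->.
Qed.

Lemma factory_vulns_cve_assignable (recognised : set nat) v :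
  (forall i : 'I_11, recognised (tnth base_cwe i)) ->
  factory_vulns F v -> cve_assignable recognised F v.
Proof.
move=> rec Fv; split.
- by have /tnthP[i ->] := factory_vulns_cwe v Fv.
- split; first exact: factory_vulns_built.
  by move=> k; rewrite count_uniq_mem ?names_deployed_uniq ?leq_b1.
- move=> k vk; apply: single_fault_independently_fixable.
    exact: deployed_single_fault.
  exact: factory_vulns_present.
Qed.

(** * Cardinality *)

Lemma module_vulns_finite n : finite_set (module_vulns F n).
Proof. by rewrite /module_vulns !finite_setU; do !split; apply: finite_set1. Qed.

Lemma factory_vulns_countable : countable (factory_vulns F).
Proof.
(* Adding the base set to every term turns the whole set into a single countable union of finite
   sets. *)
have sub : factory_vulns F `<=` \bigcup_n (base_vulns F `|` module_vulns F n).
  by move=> v [bv|[n _ nv]]; [exists 0; last left|exists n; last right].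
apply: sub_countable (subset_card_le sub) _.
apply: bigcup_countable => // n _; apply: finite_set_countable.
rewrite finite_setU; split; last exact: module_vulns_finite.
exact/finite_image/finite_finset.
Qed.

(** One stack overflow is taken from each module; the component alone makes this choice injective,
    by [lib_inj]. *)
Lemma factory_vulns_infinite : [set: nat] #<= factory_vulns F.
Proof.
pose f n := Vuln (lib F n) 121 (StackBuffer (16 + n)).
have f_inj : injective f by move=> m n [/lib_inj].
have /card_esym/card_eqPle[le_f _] : f @` [set: nat] #= [set: nat].
  by apply: inj_card_eq => m n _ _ /f_inj.
apply: card_le_trans le_f _; apply: subset_card_le => _ [n _ <-].
by right; exists n => //; do 4!left.
Qed.

End Factory.

Theorem theorem4p4 (C : eqType) (F : factory C) (recognised : set nat)
    (recognised_base : forall i : 'I_11, recognised (tnth base_cwe i)) :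
  [/\ factory_vulns F #= [set: nat],
      forall v w, factory_vulns F v -> factory_vulns F w -> v <> w -> distinct v w
    & forall v, factory_vulns F v -> cve_assignable recognised F v].
Proof.
split; last by move=> v; apply: factory_vulns_cve_assignable.
  apply/card_eqPle; split; first exact: factory_vulns_countable.
  exact: factory_vulns_infinite.
exact: factory_vulns_distinct.
Qed.
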